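(* Let $\mathbb{K}=\mathbb{R}$ or $\mathbb{K}=\mathbb{C}$ and let $n\ge 1$ be an integer. The associative $\mathbb{K}$-algebra $\mathrm{M}_n(\mathbb{K})$ of $n\times n$ matrices over $\mathbb{K}$ can be realized as a $\Gamma$-commutative algebra for some abelian group $\Gamma$ and some bilinear map $\langle\,,\,\rangle:\Gamma\times\Gamma\to\mathbb{Z}_2$ if and only if $n=2^m$ for some integer $m\ge 0$.
   Context: $\Gamma$-commutative algebra: given an abelian group $(\Gamma,+)$ and a bilinear map $\langle\,,\,\rangle:\Gamma\times\Gamma\to\mathbb{Z}_2$, a $\mathbb{K}$-algebra $\mathcal{A}$ is $\Gamma$-commutative if it is $\Gamma$-graded, $\mathcal{A}=\bigoplus_{\gamma\in\Gamma}\mathcal{A}_\gamma$ (as $\mathbb{K}$-vector spaces) with $\mathcal{A}_\gamma\cdot\mathcal{A}_{\gamma'}\subset\mathcal{A}_{\gamma+\gamma'}$, and $ab=(-1)^{\langle\bar a,\bar b\rangle}\,ba$ for all homogeneous $a,b\in\mathcal{A}$, where $\bar a,\bar b\in\Gamma$ denote the degrees. ''Can be realized'' means that the algebra admits such a grading. *)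

(* Defs.v *)
From mathcomp Require Import all_boot all_order all_algebra.
From mathcomp Require Import reals complex.
Set Implicit Arguments.
Unset Strict Implicit.
Unset Printing Implicit Defensive.
Import GRing.Theory.
Local Open Scope ring_scope.

(* Bilinearity of abelian groups, i.e. over the integers. No symmetry is
   required. *)
Definition biadditive (G H : zmodType) (f : G -> G -> H) : Prop :=
  (forall x, GRing.zmod_morphism (f x)) /\
  (forall y, GRing.zmod_morphism (f^~ y)).

(* V is the direct sum of the subspaces C g. The index type may be infinite, so
   only finite subfamilies are summed. *)
Definition direct_sum_decomposition (K : fieldType) (V : lmodType K)
    (G : eqType) (C : G -> {pred V}) : Prop :=
  [/\ forall g, submod_closed (C g),
      forall v, exists (s : seq G) (f : G -> V),
        [/\ uniq s, forall g, f g \in C g & v = \sum_(g <- s) f g]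
    & forall (s : seq G) (f : G -> V),
        uniq s -> (forall g, f g \in C g) -> \sum_(g <- s) f g = 0 ->
        forall g, g \in s -> f g = 0].

Definition algebra_grading (K : fieldType) (A : algType K) (G : zmodType)
    (C : G -> {pred A}) : Prop :=
  direct_sum_decomposition C /\
  (forall g h a b, a \in C g -> b \in C h -> a * b \in C (g + h)).

(* The exponent in (-1) ^+ _ is the representative of form g h in {0, 1}. *)
Definition graded_commutative (K : fieldType) (A : algType K) (G : zmodType)
    (form : G -> G -> 'Z_2) (C : G -> {pred A}) : Prop :=
  forall g h a b, a \in C g -> b \in C h ->
    a * b = (-1) ^+ (form g h) * (b * a).

Definition realizable_as_graded_commutative (K : fieldType) (A : algType K) :
    Prop :=
  exists (G : zmodType) (form : G -> G -> 'Z_2) (C : G -> {pred A}),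
    [/\ biadditive form, algebra_grading C & graded_commutative form C].

(* Main.v *)
Require Import Defs.
From HB Require Import structures.
From mathcomp Require Import all_boot all_order all_algebra.
From mathcomp Require Import falgebra.
From mathcomp Require Import reals complex boolp.
Set Implicit Arguments.
Unset Strict Implicit.
Unset Printing Implicit Defensive.
Import GRing.Theory.
Local Open Scope ring_scope.

(** Suppose a matrix algebra is graded-commutative. Two homogeneous elements
    commute up to a sign, so the product of two elements of the same degree g
    commutes with everything up to the square of a sign
    ([homogeneous_mul_central]), hence is a scalar. A nonzero homogeneous a has
    a nonzero scalar square: if a * a = 0 then a * b * a = +- a * a * b = 0 for
    every homogeneous b, which forces a = 0 ([homogeneous_sqr_scalar]). So
    nonzero homogeneous elements are invertible, every nonzero component is a
    line ([homogeneous_line]), and the degrees that occur form a subgroup. As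
    a * a is a nonzero scalar, 1 has degree 2 g for each occurring g, and
    1 * 1 = 1 gives 2 g = 0. The degrees thus form a finite elementary abelian
    2-group with as many elements as the dimension, and n ^ 2, hence n, is a
    power of 2 ([realizable_pow2]). The argument works in every
    finite-dimensional semiprime algebra whose centre consists of scalars.

    Conversely, for n = 2 ^ m, let V be the space of row vectors of length m
    over Z/2, index the basis of K ^ n by V, and let the Weyl matrix of (u, v)
    send the basis vector of x to (-1) ^ (v . x) times that of x + u. Weyl
    matrices multiply up to sign like the elements of V x V ([weylM]) and
    commute up to the sign given by the symplectic form ([weyl_comm]). That
    form is nondegenerate, so a Weyl matrix of nonzero index anticommutes with
    another one, an invertible matrix, and therefore has trace 0
    ([trace_weyl]). The trace form then separates the Weyl matrices
    ([weyl_independent]), and as there are n ^ 2 of them, they are a basis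
    whose lines are the components of a grading. Both directions hold over any
    field of characteristic other than 2 ([realizable_iff_pow2]). *)

(** * Signs with exponents modulo 2 *)

(** The exponent of the left-hand side is reduced modulo 2. *)
Lemma expr_Z2D (K : pzRingType) (x : K) (u v : 'Z_2) :
  x ^+ 2 = 1 -> x ^+ (u + v)%R = x ^+ u * x ^+ v.
Proof. by move=> x2; rewrite -exprD -(expr_mod (u + v)%N x2). Qed.

Lemma addZ2 (u : 'Z_2) : u + u = 0.
Proof. by case: u => [[|[|u]] lt_u2] //; apply: val_inj. Qed.

Lemma sign_mulss (K : pzRingType) (u : 'Z_2) : (-1) ^+ u * (-1) ^+ u = 1 :> K.
Proof. by rewrite -expr_Z2D ?sqrrN ?expr1n // addZ2 expr0. Qed.

(** * Finite elementary abelian 2-groups *)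

(** The subgroup P may live in an infinite group and is finite only through the
    bound B. Adjoining to a finite subgroup its coset through a new element of
    P doubles the size, so a finite subgroup of order 2 ^ m with m maximal is
    all of P. *)
Lemma card_finite_elementary_2group (G : zmodType) (P : pred G) (B : nat) :
    0 \in P -> {in P &, forall g h, g + h \in P} ->
    {in P, forall g, g + g = 0} ->
    (forall s : seq G, uniq s -> {subset s <= P} -> (size s <= B)%N) ->
  exists m (s : seq G), [/\ uniq s, s =i P & size s = (2 ^ m)%N].
Proof.
move=> P0 PD Pexp2 Pbound.
pose subgroup_of_rank m := `[< exists s : seq G,
  [/\ uniq s, {subset s <= P}, size s = (2 ^ m)%N
    & {in s &, forall g h, g + h \in s}] >].
have rank0 : exists m, subgroup_of_rank m.
  exists 0%N; apply/asboolP; exists [:: 0]; split=> //.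
    by move=> g; rewrite inE => /eqP->.
  by move=> g h; rewrite !inE => /eqP-> /eqP->; rewrite addr0.
have rank_le m : subgroup_of_rank m -> (m <= B)%N.
  move=> /asboolP[s [s_uniq sP s_size _]].
  apply: leq_trans (ltnW (ltn_expl m (isT : 1 < 2)%N)) _.
  by rewrite -s_size Pbound.
case: (ex_maxnP rank0 rank_le) => m /asboolP[s [s_uniq sP s_size sD]] m_max.
exists m, s; split=> // g; apply/idP/idP => [/sP //|Pg].
apply: contraT => sNg.
(* The union of the subgroup and its coset through g is a larger subgroup. *)
suff : (m.+1 <= m)%N by rewrite ltnn.
have coset h : (h \in [seq k + g | k <- s]) = (h - g \in s).
  by have := mem_map (@addIr _ g) s (h - g); rewrite /= subrK.
have Ng : - g = g by apply/eqP; rewrite eq_sym -addr_eq0 Pexp2.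
apply/m_max/asboolP; exists (s ++ [seq h + g | h <- s]); split.
- rewrite cat_uniq s_uniq map_inj_uniq ?s_uniq ?andbT; last exact: addIr.
  apply/hasPn => h; rewrite coset Ng => s_hg; apply: contra sNg => s_h.
  by have := sD _ _ s_h s_hg; rewrite addrA Pexp2 ?add0r // sP.
- move=> h; rewrite mem_cat coset Ng => /orP[/sP //|/sP Ph].
  by rewrite -[h](addrK g) Ng PD.
- by rewrite size_cat size_map s_size addnn -mul2n expnS.
- move=> h k; rewrite !mem_cat !coset Ng => /orP[sh|sh] /orP[sk|sk];
    apply/orP.
  + by left; exact: sD.
  + by right; rewrite -addrA; exact: sD.
  + by right; rewrite addrAC; exact: sD.
  + by left; have := sD _ _ sh sk; rewrite addrACA Pexp2 ?addr0.
Qed.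

(** * Gradings of central semiprime algebras *)

Section GradedCommutativeCentralSemiprime.

Variables (K : fieldType) (A : falgType K).
Hypothesis central_scalar :
  forall a : A, (forall b, a * b = b * a) -> exists k, a = k%:A.
Hypothesis semiprime : forall a : A, (forall b, a * b * a = 0) -> a = 0.

Variables (G : zmodType) (form : G -> G -> 'Z_2) (C : G -> {pred A}).
Hypothesis gradC : algebra_grading C.
Hypothesis gcommC : graded_commutative form C.

Lemma graded0 g : 0 \in C g.
Proof. by case: gradC => -[/(_ g)[]]. Qed.

Lemma gradedZ g k a : a \in C g -> k *: a \in C g.
Proof.
case: gradC => -[/(_ g)[C0 Clin] _ _] _ Ca.
by rewrite -[_ *: _]addr0 Clin.
Qed.

Lemma gradedM g h a b : a \in C g -> b \in C h -> a * b \in C (g + h).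
Proof. by case: gradC => _; apply. Qed.

(** Independence applied to a in degree g and - a in degree h. *)
Lemma homogeneous_degree_uniq g h a :
  a \in C g -> a \in C h -> a != 0 -> g = h.
Proof.
move=> Ca Da a0; case: gradC => -[Csub _ indep] _.
apply: contraNeq a0 => gh.
pose f k := if k == g then a else if k == h then - a else 0.
have := indep [:: g; h] f; rewrite !big_cons big_nil /f eqxx eq_sym (negPf gh).
rewrite eqxx addr0 subrr /= inE gh => /(_ isT _ erefl g).
rewrite eqxx mem_head => -> // k.
have [->//|_] := eqVneq k g; have [->|_] := eqVneq k h; last exact: graded0.
by rewrite -scaleN1r gradedZ.
Qed.

(** Moving a homogeneous c of degree h past a and past b costs the same sign
    form g h twice. *)
Lemma homogeneous_mul_central g a b c :
  a \in C g -> b \in C g -> a * b * c = c * (a * b).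
Proof.
move=> Ca Cb; case: (gradC) => -[_ /(_ c)[s [f [_ Cf ->]]] _] _.
rewrite mulr_sumr mulr_suml; apply: eq_bigr => h _.
rewrite -mulrA (gcommC Cb (Cf h)) (mulrA a).
rewrite (commr_sign a) -!mulrA (mulrA a) (gcommC Ca (Cf h)) !mulrA.
by rewrite sign_mulss mul1r.
Qed.

Lemma homogeneous_mul_scalar g a b :
  a \in C g -> b \in C g -> exists k, a * b = k%:A.
Proof.
move=> Ca Cb; apply: central_scalar => c.
exact: homogeneous_mul_central Ca Cb.
Qed.

(** If the scalar were 0, then a * b * a = +- a * a * b = 0 for homogeneous b,
    hence for all b, against semiprimeness. *)
Lemma homogeneous_sqr_scalar g a :
  a \in C g -> a != 0 -> exists2 k, k != 0 & a * a = k%:A.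
Proof.
move=> Ca a0; have [k aa] := homogeneous_mul_scalar Ca Ca.
exists k => //; apply: contraNneq a0 => k0; apply/eqP/semiprime => b.
case: (gradC) => -[_ /(_ b)[s [f [_ Cf ->]]] _] _.
rewrite mulr_sumr mulr_suml big1 // => h _.
by rewrite -mulrA (gcommC (Cf h) Ca) (mulrA a) (commr_sign a) -!mulrA
  (mulrA a a) aa k0 scale0r mul0r mulr0.
Qed.

Lemma homogeneous_mul_neq0 g a b :
  a \in C g -> a != 0 -> b != 0 -> a * b != 0.
Proof.
move=> Ca a0 b0; apply: contraNneq b0 => ab0.
have [k k0 aa] := homogeneous_sqr_scalar Ca a0.
have /eqP := congr1 ( *%R a) ab0.
by rewrite mulrA aa mulr0 -scalerAl mul1r scaler_eq0 (negPf k0).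
Qed.

(** With a * a = k and a * b = l scalars, evaluating a * a * b in two ways gives
    k b = l a. *)
Lemma homogeneous_line g a b :
  a \in C g -> a != 0 -> b \in C g -> exists k, b = k *: a.
Proof.
move=> Ca a0 Cb.
have [k k0 aa] := homogeneous_sqr_scalar Ca a0.
have [l ab] := homogeneous_mul_scalar Ca Cb.
exists (k^-1 * l); apply: (scalerI k0); rewrite scalerA mulrA divff // mul1r.
have := mulrA a a b; rewrite aa ab -scalerAl mul1r => <-.
by rewrite -scalerAr mulr1.
Qed.

(** The dimension counts the degrees of nonzero components, each of them a
    line; these degrees are closed under addition because products of nonzero
    homogeneous elements do not vanish, and have exponent 2 because the scalar
    a * a is homogeneous of degree 2 g. *)
Lemma dim_graded_commutative : exists m, dim A = (2 ^ m)%N.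
Proof.
(* b g spans the component of degree g, and is 0 where the component is. *)
have /choice[b Cb] : forall g, exists x, x \in C g /\
    forall a, a \in C g -> exists k, a = k *: x.
  move=> g.
  have [[a [Ca a0]]|noa] := pselect (exists a, a \in C g /\ a != 0).
    by exists a; split=> // c; exact: homogeneous_line Ca a0.
  exists 0; split=> [|c Cc]; first exact: graded0.
  exists 0; rewrite scale0r; apply/eqP; apply: contraT => c0.
  by case: noa; exists c.
pose S : pred G := [pred g | b g != 0].
have freeb s : uniq s -> {subset s <= S} -> free (map b s).
  move=> s_uniq sS; pose X := map_tuple b (in_tuple s).
  apply: (introT (freeP (X := X))) => k; rewrite /X /= => sum0 i.
  pose f g := if insub (index g s) is Some j then k j *: b g else 0.
  have fE (j : 'I_(size s)) : f s`_j = k j *: b s`_j.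
    by rewrite /f index_uniq // valK.
  case: (gradC) => -[_ _ /(_ s f s_uniq)] indep _.
  have si : s`_i \in s by rewrite mem_nth.
  have /eqP : f s`_i = 0.
    apply: indep => //.
      by move=> g; rewrite /f; case: insubP => *; rewrite ?graded0 // gradedZ
        ?(proj1 (Cb g)).
    rewrite (big_nth 0) big_mkord -[RHS]sum0; apply: eq_bigr => j _.
    by rewrite fE (nth_map 0).
  by rewrite fE scaler_eq0 (negPf (sS _ si : _ != 0)) orbF => /eqP.
have spanS (s : seq G) : s =i S -> <<map b s>>%VS = fullv.
  move=> sS; apply/vspaceP => v; rewrite memvf.
  case: (gradC) => -[_ /(_ v)[t [f [_ Cf ->]]] _] _.
  apply: memv_suml => g _; have [k ->] := proj2 (Cb g) _ (Cf g).
  have [->|bg] := eqVneq (b g) 0; first by rewrite scaler0 mem0v.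
  by rewrite memvZ // memv_span // map_f // sS.
have [g0 Sg0] : exists g, g \in S.
  apply: contrapT => noS; have /eqP := oner_neq0 A; apply.
  case: (gradC) => -[_ /(_ 1)[t [f [_ Cf ->]]] _] _.
  rewrite big1 // => g _; have [k ->] := proj2 (Cb g) _ (Cf g).
  have [->|bg] := eqVneq (b g) 0; first by rewrite scaler0.
  by case: noS; exists g.
have one_deg g : g \in S -> 1 \in C (g + g).
  move=> Sg; have [k k0 bb] := homogeneous_sqr_scalar (proj1 (Cb g)) Sg.
  have := gradedZ k^-1 (gradedM (proj1 (Cb g)) (proj1 (Cb g))).
  by rewrite bb scalerA mulVf // scale1r.
have S2 : {in S, forall g, g + g = 0}.
  move=> g /one_deg C1; apply: (addIr (g + g)); rewrite add0r.
  have := gradedM C1 C1; rewrite mulr1 => C11.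
  exact: homogeneous_degree_uniq C11 C1 (oner_neq0 _).
have memS g a : a \in C g -> a != 0 -> g \in S.
  move=> Ca; apply: contraNneq => bg; have [k ->] := proj2 (Cb g) _ Ca.
  by rewrite bg scaler0.
have S0 : 0 \in S.
  by rewrite -(S2 g0) //; apply: memS (one_deg _ Sg0) (oner_neq0 _).
have SD : {in S &, forall g h, g + h \in S}.
  move=> g h Sg Sh; apply: memS (gradedM (proj1 (Cb g)) (proj1 (Cb h))) _.
  exact: homogeneous_mul_neq0 (proj1 (Cb g)) Sg Sh.
have Sbound (s : seq G) : uniq s -> {subset s <= S} -> (size s <= dim A)%N.
  move=> s_uniq sS; have /eqP := freeb s s_uniq sS; rewrite size_map => <-.
  by rewrite -dimvf dimvS // subvf.
have [m [s [s_uniq sS s_size]]] :=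
  card_finite_elementary_2group S0 SD S2 Sbound.
exists m; rewrite -s_size -(size_map b) -dimvf -(spanS s sS).
by apply/eqP; apply: freeb => // g; rewrite sS.
Qed.

End GradedCommutativeCentralSemiprime.

(** Compare the (i, 0) entries of the products with a matrix unit (j, 0). *)
Lemma mx_central_scalar (K : fieldType) n (a : 'M[K]_n.+1) :
  (forall b, a * b = b * a) -> exists k, a = k%:A.
Proof.
move=> ca; exists (a 0 0); apply/matrixP => i j.
have /matrixP/(_ i 0) := ca (delta_mx j 0).
rewrite !mxE (bigD1 j) //= !mxE !eqxx mulr1 big1 => [|k kj]; last first.
  by rewrite mxE (negPf kj) mulr0.
rewrite addr0 => ->; rewrite (bigD1 0) //= !mxE eqxx andbT big1 => [|k k0].
  by rewrite addr0 mulrC.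
by rewrite mxE (negPf k0) andbF mul0r.
Qed.

(** With b the matrix unit (j, i), the (i, j) entry of a * b * a is the square
    of that of a. *)
Lemma mx_semiprime (K : fieldType) n (a : 'M[K]_n.+1) :
  (forall b, a * b * a = 0) -> a = 0.
Proof.
move=> aba; apply/matrixP => i j; rewrite mxE.
have /matrixP/(_ i j) := aba (delta_mx j i).
rewrite !mxE (bigD1 i) //= big1 => [|k ki]; last first.
  rewrite mxE big1 ?mul0r // => l _.
  by rewrite mxE (negPf ki) andbF mulr0.
rewrite mxE (bigD1 j) //= big1 => [|k kj]; last first.
  by rewrite mxE (negPf kj) mulr0.
by rewrite mxE !eqxx mulr1 !addr0 => /eqP; rewrite mulf_eq0 orbb => /eqP.
Qed.

Lemma realizable_pow2 (K : fieldType) n :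
  @realizable_as_graded_commutative K 'M[K]_n.+1 ->
  exists m, n.+1 = (2 ^ m)%N.
Proof.
move=> [G [form [C [_ gradC gcommC]]]].
have [k] := dim_graded_commutative (@mx_central_scalar K n)
  (@mx_semiprime K n) gradC gcommC.
rewrite dim_matrix => dimE.
have /(dvdn_pfactor _ _ (isT : prime 2))[m _ ->] : (n.+1 %| 2 ^ k)%N.
  by rewrite -dimE dvdn_mulr.
by exists m.
Qed.


(** * Gradings with one-dimensional components *)

Lemma scaler_signE (K : fieldType) (A : algType K) k (a : A) :
  (-1) ^+ k *: a = (-1) ^+ k * a.
Proof. by rewrite -signr_odd -[in RHS]signr_odd scaler_sign mulr_sign. Qed.

(** Independence and the dimension count make the family T a basis; the grading
    consists of the lines that it spans. *)
Lemma realizable_of_homogeneous_basis (K : fieldType) (A : falgType K)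
    (G : finZmodType) (form : G -> G -> 'Z_2) (T : G -> A) :
    biadditive form ->
    (forall g h, T g * T h \in <[T (g + h)%R]>%VS) ->
    (forall g h, T g * T h = (-1) ^+ form g h * (T h * T g)) ->
    (forall c : G -> K, \sum_g c g *: T g = 0 -> forall g, c g = 0) ->
    #|G| = dim A ->
  realizable_as_graded_commutative A.
Proof.
move=> form_bi TM Tcomm Tindep cardG.
exists G, form, (fun g : G => mem <[T g]>%VS : {pred A}).
split=> //; last first.
  move=> g h _ _ /vlineP[k ->] /vlineP[l ->].
  by rewrite -!scalerAl -!scalerAr Tcomm !scalerA mulrC.
split; last first.
  move=> g h _ _ /vlineP[k ->] /vlineP[l ->].
  by rewrite -scalerAl -scalerAr; exact: memvZ (memvZ _ (TM g h)).
split.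
- move=> g; split=> [|k a b Ca Cb]; first exact: mem0v.
  exact: memvD (memvZ _ Ca) Cb.
- move=> v; pose X := map_tuple T (enum_tuple G).
  have freeX : free X.
    apply/freeP => k sum0 i.
    have kE := Tindep (fun g => k (enum_rank g)).
    rewrite -(enum_valK i) kE // (reindex_onto enum_val enum_rank) => [|g _];
      last exact: enum_rankK.
      rewrite -[RHS]sum0; apply: eq_big => [j|j _].
        by rewrite enum_valK eqxx.
      by rewrite enum_valK -tnth_nth tnth_map (tnth_nth 0) -enum_val_nth.
  have : v \in <<X>>%VS.
    suff /span_basis-> : basis_of fullv X by exact: memvf.
    by rewrite basisEfree freeX subvf dimvf -cardG size_tuple /=.
  rewrite span_def big_map big_enum => /memv_sumP[f Tf ->].
  exists (enum G), f; split; first exact: enum_uniq.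
    by move=> g; exact: Tf.
  by rewrite big_enum.
- move=> s f s_uniq Cf sum0 g sg.
  have /choice[c fE] : forall h, exists k, f h = k *: T h.
    by move=> h; apply/vlineP; exact: Cf.
  rewrite fE (_ : c g = 0) ?scale0r //.
  have := Tindep (fun h => if h \in s then c h else 0).
  move=> /(_ _ g); rewrite sg; apply; apply: etrans sum0.
  rewrite [RHS]big_uniq // [RHS]big_mkcond /=.
  by apply: eq_bigr => h _; rewrite fE; case: ifP; rewrite ?scale0r.
Qed.

(** * Weyl matrices *)

(* Makes the product of two finite additive groups a finite additive group. *)
HB.saturate prod.

Section WeylMatrices.

Variables (K : fieldType) (m n : nat).
Hypothesis two_neq0 : 2%:R != 0 :> K.
Hypothesis n_pow2 : n.+1 = (2 ^ m)%N.

Local Notation V := 'rV['Z_2]_m.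

Lemma addVV (g : V * V) : g + g = 0.
Proof.
by case: g => u v; congr (_, _); apply/rowP => i; rewrite !mxE addZ2.
Qed.

(* Throughout, a pair (u, v) : V * V indexes the operator that translates by u
   and modulates by the sign character of v. *)
Definition dotZ2 (u v : V) : 'Z_2 := (u *m v^T) 0 0.

Lemma dotZ2Dl u v w : dotZ2 (u + v) w = dotZ2 u w + dotZ2 v w.
Proof. by rewrite /dotZ2 mulmxDl mxE. Qed.

Lemma dotZ2Dr u v w : dotZ2 w (u + v) = dotZ2 w u + dotZ2 w v.
Proof. by rewrite /dotZ2 linearD mulmxDr mxE. Qed.

Lemma dotZ2C u v : dotZ2 u v = dotZ2 v u.
Proof. by rewrite /dotZ2 !mxE; apply: eq_bigr => i _; rewrite !mxE mulrC. Qed.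

Lemma dotZ2_delta u i : dotZ2 (delta_mx 0 i) u = u 0 i.
Proof. by rewrite /dotZ2 -rowE !mxE. Qed.

Definition symplecticZ2 (g h : V * V) : 'Z_2 := dotZ2 g.2 h.1 + dotZ2 h.2 g.1.

Lemma symplecticZ2C g h : symplecticZ2 g h = symplecticZ2 h g.
Proof. exact: addrC. Qed.

(** Subtraction coincides with addition on both sides. *)
Lemma symplecticZ2_biadditive : biadditive symplecticZ2.
Proof.
have NZ2 (u : 'Z_2) : - u = u by apply/eqP; rewrite eq_sym -addr_eq0 addZ2.
have NV (u : V) : - u = u by apply/rowP => i; rewrite mxE NZ2.
have morph g : GRing.zmod_morphism (symplecticZ2 g).
  move=> [u v] [u' v']; rewrite /symplecticZ2 /= !NV NZ2 dotZ2Dl dotZ2Dr.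
  by rewrite addrACA.
split=> // h g g'; rewrite ![symplecticZ2 _ h]symplecticZ2C; exact: morph.
Qed.

Lemma symplecticZ2_nondegenerate g :
  g != 0 -> exists h, symplecticZ2 g h = 1.
Proof.
case: g => u v uv0.
have nz (w : V) : w != 0 -> exists i, w 0 i = 1.
  move=> /rV0Pn[i wi]; exists i; move: wi.
  by case: (w 0 i) => [[|[|k]] lt_k2] // _; apply: val_inj.
have [u0|/nz[i ui]] := eqVneq u 0; last first.
  exists (0, delta_mx 0 i); rewrite /symplecticZ2 /= dotZ2_delta ui.
  by rewrite /dotZ2 trmx0 mulmx0 mxE add0r.
have /nz[i vi] : v != 0 by apply: contraNneq uv0 => ->; rewrite u0.
exists (delta_mx 0 i, 0); rewrite /symplecticZ2 /= dotZ2C dotZ2_delta vi.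
by rewrite /dotZ2 mul0mx mxE addr0.
Qed.

Lemma card_rV_Z2 : #|{: V}| = n.+1.
Proof. by rewrite card_mx card_ord mul1n n_pow2. Qed.

Definition pos_rV (i : 'I_n.+1) : V := enum_val (cast_ord (esym card_rV_Z2) i).
Definition rV_pos (v : V) : 'I_n.+1 := cast_ord card_rV_Z2 (enum_rank v).

Lemma pos_rVK : cancel pos_rV rV_pos.
Proof. by move=> i; rewrite /rV_pos /pos_rV enum_valK cast_ordKV. Qed.

Lemma rV_posK : cancel rV_pos pos_rV.
Proof. by move=> v; rewrite /rV_pos /pos_rV cast_ordK enum_rankK. Qed.

Definition weyl (g : V * V) : 'M[K]_n.+1 :=
  \matrix_(i, j) ((-1) ^+ dotZ2 g.2 (pos_rV j)
                  *+ (pos_rV i == pos_rV j + g.1)).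

Lemma weylM g h : weyl g * weyl h = (-1) ^+ dotZ2 g.2 h.1 *: weyl (g + h).
Proof.
apply/matrixP => i k; rewrite !mxE (bigD1 (rV_pos (pos_rV k + h.1))) //=.
rewrite !mxE rV_posK eqxx big1 => [|j jk]; last first.
  rewrite !mxE [pos_rV j == _]negbTE ?mulr0 //.
  by apply: contraNneq jk => <-; rewrite pos_rVK.
rewrite addr0 mulr1n mulrnAl mulrnAr -addrA [h.1 + g.1]addrC; congr (_ *+ _).
rewrite dotZ2Dr dotZ2Dl !expr_Z2D ?sqrrN ?expr1n //.
by rewrite [RHS]mulrCA mulrA.
Qed.

Lemma weyl0 : weyl 0 = 1.
Proof.
apply/matrixP => i j; rewrite !mxE addr0 (can_eq pos_rVK).
by rewrite /dotZ2 mul0mx mxE expr0.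
Qed.

Lemma weyl_comm g h :
  weyl g * weyl h = (-1) ^+ symplecticZ2 g h * (weyl h * weyl g).
Proof.
rewrite !weylM -scaler_signE scalerA [h + g]addrC expr_Z2D ?sqrrN ?expr1n //.
by rewrite -mulrA sign_mulss mulr1.
Qed.

Lemma weyl_sqr g : weyl g * weyl g = (-1) ^+ dotZ2 g.2 g.1 *: 1.
Proof. by rewrite weylM addVV weyl0. Qed.

(** A Weyl matrix of nonzero index anticommutes with some Weyl matrix, whose
    square is +- 1. *)
Lemma trace_weyl g : g != 0 -> \tr (weyl g) = 0.
Proof.
move=> /symplecticZ2_nondegenerate[h gh].
(* weyl h * weyl g * weyl h has the trace of weyl g times the scalar weyl h ^ 2,
   by cyclicity, and also the opposite of it, by anticommutation. *)
have anti : weyl g *m weyl h = - (weyl h *m weyl g).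
  by rewrite -[LHS]/(weyl g * weyl h) weyl_comm gh expr1 mulN1r.
have hh : weyl h *m weyl h = (-1) ^+ dotZ2 h.2 h.1 *: 1 by exact: weyl_sqr.
have : \tr (weyl h *m (weyl g *m weyl h)) =
       - \tr (weyl h *m (weyl h *m weyl g)).
  by rewrite anti mulmxN raddfN.
rewrite mxtrace_mulC -mulmxA (mulmxA _ _ (weyl g)) hh -scalemxAl.
rewrite -scalemxAr mul1mx mulmx1.
move=> /eqP; rewrite -addr_eq0 -mulr2n -mulr_natl mulf_eq0 (negPf two_neq0) /=.
by rewrite mxtraceZ mulf_eq0 signr_eq0 => /eqP.
Qed.

(** The trace of weyl h * weyl g is 0 unless h = g, when it is +- n.+1, which is
    invertible as a power of 2. *)
Lemma weyl_independent (c : V * V -> K) :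
  \sum_g c g *: weyl g = 0 -> forall g, c g = 0.
Proof.
move=> sum0 g; have := congr1 (fun a => \tr (a * weyl g)) sum0.
rewrite mul0r mxtrace0 mulr_suml raddf_sum (bigD1 g) //= big1 => [|h hg].
  rewrite addr0 -scalerAl weyl_sqr !mxtraceZ mxtrace1 n_pow2 natrX => /eqP.
  by rewrite !mulf_eq0 signr_eq0 expf_eq0 (negPf two_neq0) andbF !orbF => /eqP.
rewrite -scalerAl weylM !mxtraceZ trace_weyl ?mulr0 //.
apply: contraNneq hg => hg0.
by rewrite -(addIr g (etrans hg0 (esym (addVV g)))).
Qed.

Lemma realizable_weyl : @realizable_as_graded_commutative K 'M[K]_n.+1.
Proof.
apply: (realizable_of_homogeneous_basis (T := weyl) symplecticZ2_biadditive).
- by move=> g h; rewrite weylM memvZ // memv_line.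
- exact: weyl_comm.
- exact: weyl_independent.
- by rewrite card_prod card_rV_Z2 dim_matrix.
Qed.

End WeylMatrices.

(** * Matrix algebras in characteristic other than 2 *)

Lemma realizable_iff_pow2 (K : fieldType) (n : nat) :
  2%:R != 0 :> K ->
  @realizable_as_graded_commutative K 'M[K]_n.+1 <->
  exists m, n.+1 = (2 ^ m)%N.
Proof.
move=> two_neq0; split; first exact: realizable_pow2.
by move=> [m n_pow2]; exact: realizable_weyl two_neq0 n_pow2.
Qed.

Theorem corollary1p1 (R : realType) (n : nat) :
  (@realizable_as_graded_commutative R 'M[R]_n.+1 <->
    exists m : nat, n.+1 = (2 ^ m)%N) /\
  (@realizable_as_graded_commutative R[i] 'M[R[i]]_n.+1 <->
    exists m : nat, n.+1 = (2 ^ m)%N).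
Proof. by split; apply: realizable_iff_pow2; rewrite Num.Theory.pnatr_eq0. Qed.
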